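(* Let $r\ge 2$ and $p\ge (2r-1)r+2(r-1)$ be integers. Then $C_r(n,K_p^{(r)})=\Omega\!\left(n^{\frac{r}{r+1}}\right)$ as $n\to\infty$.
   Context: An $r$-graph is an $r$-uniform hypergraph; $K_n^{(r)}$ is the complete $r$-graph on $n$ vertices. A copy of an $r$-graph $H$ in $K_n^{(r)}$ is a subhypergraph isomorphic to $H$. An $(n,r,H)$-local coloring with $k$ colors is a family of edge-colorings $f_v:E(K_n^{(r)})\to[k]$, one per vertex $v$, such that for every copy $T$ of $H$ there is $u\in V(T)$ with $f_u$ injective on $E(T)$ (i.e. $T$ is rainbow under $f_u$). $C_r(n,H)$ is the minimum such $k$. *)

(* Defs.v *)
From mathcomp Require Import all_boot.
From Stdlib Require Import Reals.
Set Implicit Arguments. Unset Strict Implicit. Unset Printing Implicit Defensive.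

(* Vertices of K_n^(r): 'I_n.  Edges: sets e : {set 'I_n} with #|e| = r.
   A colouring with k colours [k] is a function {set 'I_n} -> 'I_k (only its
   values on r-sets matter).  A local colouring is one colouring f v per vertex.
   Copies of K_p^(r) in K_n^(r) are exactly the p-subsets S of vertices, with
   edge set the r-subsets of S. *)

Definition edges_of (r n : nat) (S : {set 'I_n}) : {set {set 'I_n}} :=
  [set e : {set 'I_n} | (e \subset S) && (#|e| == r)].

Definition rainbow (n k : nat) (g : {ffun {set 'I_n} -> 'I_k})
  (E : {set {set 'I_n}}) : bool :=
  [forall e1 in E, forall e2 in E, (g e1 == g e2) ==> (e1 == e2)].

Definition local_coloring (r n p k : nat)
  (f : {ffun 'I_n -> {ffun {set 'I_n} -> 'I_k}}) : bool :=
  [forall S : {set 'I_n}, (#|S| == p) ==>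
     [exists u in S, rainbow (f u) (edges_of r S)]].


Definition has_local_coloring (r n p k : nat) : bool :=
  [exists f, @local_coloring r n p k f].

(* Convention: for p = 0 (the empty hypergraph, no vertex to witness) no local
   colouring exists; we then set C_r = 0.  Irrelevant for the theorem (p >= 8). *)
Definition Cpred (r n p : nat) : pred nat :=
  fun k => (p == 0) || has_local_coloring r n p k.

Lemma Cpred_ex (r n p : nat) : exists k, Cpred r n p k.
Proof.
case: (posnP p) => [->|p0]; first by exists 0.
exists #|{set 'I_n}|; apply/orP; right; apply/existsP.
exists [ffun v => [ffun e => enum_rank e]].
apply/forallP => S; apply/implyP => /eqP hS.
have : 0 < #|S| by rewrite hS.
case/card_gt0P => u uS; apply/existsP; exists u; rewrite uS /=.
apply/forallP => e1; apply/implyP => _; apply/forallP => e2; apply/implyP => _.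
apply/implyP; rewrite !ffunE => /eqP /enum_rank_inj ->; exact: eqxx.
Qed.

Definition Cr (r n p : nat) : nat := ex_minn (Cpred_ex r n p).

(* Main.v *)
Require Import Defs.
From mathcomp Require Import all_boot.
From mathcomp Require Import zify.
From Stdlib Require Import Reals Lra.

(** Let [k] colours suffice. Fix an (r-2)-set [Z] and a set [B] of [2k] further
    vertices. For each remaining vertex [a], at least [k] of the [2k] edges
    [a |: (x |: Z)], x in [B], share their [f a]-colour with another one, so by
    averaging over the [4k^2] ordered pairs some [x != y] is such a pair for a set [L] of
    about [n/(4k)] vertices [a]. Hence no [a] in [L] can be a rainbow witness for a set
    containing [a] and the r-set [W = x |: (y |: Z)].

    To disable the witnesses in [W] as well, take edges inside [L]. Each vertex
    [w] in [W] gives at most [k] of these a colour that is unique under [f w], so if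
    there are more than [rk] of them one can find at most [r+1] edges among which
    every [w] sees a repeated colour. The set obtained has at most [r + r(r+1)]
    vertices, which is at most [p], and is padded inside [L]. Therefore
    ['C(|L|, r) <= rk], i.e. [n^r = O(k^(r+1))]. *)

(** * Repeated colours in finite sets: pigeonhole and averaging *)

Lemma exists_subset_card (T : finType) (A : {set T}) (m : nat) :
  m <= #|A| -> exists2 B : {set T}, B \subset A & #|B| = m.
Proof.
move=> mA; have : 0 < #|[set B : {set T} | B \subset A & #|B| == m]|.
  by rewrite cards_draws bin_gt0.
by case/card_gt0P => B; rewrite inE => /andP[BA /eqP Bm]; exists B.
Qed.

Definition twins (T C : finType) (g : T -> C) (E : {set T}) : {set T} :=
  [set e in E | [exists e' in E, (e' != e) && (g e == g e')]].

(** On the elements of [E] that are not twins, [g] is injective. *)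
Lemma card_twins (T C : finType) (g : T -> C) (E : {set T}) :
  #|E| <= #|twins T C g E| + #|C|.
Proof.
have sub : twins T C g E \subset E by apply/subsetP => x; rewrite inE => /andP[].
rewrite -(cardsID (twins T C g E) E) (setIidPr sub) leq_add2l.
rewrite -(@card_in_imset _ _ g); first exact: max_card.
move=> x y; rewrite !inE => /andP[xn xE] /andP[yn yE] gxy.
apply/eqP/negP => xy; move: xn; rewrite xE /= => /existsP[].
by exists y; rewrite yE gxy eqxx eq_sym andbT; apply/negP.
Qed.

(** Recursing inside the twins of [g] keeps [F] small: any one element of the set found there
    already has a partner under [g], so each function costs one extra element instead of two. *)
Lemma exists_repeating_subset (T C : finType) (gs : seq (T -> C)) (E : {set T}) :
  size gs * #|C| < #|E| ->
  exists F : {set T}, [/\ F \subset E, 0 < #|F|, #|F| <= (size gs).+1 &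
    forall i, i < size gs -> forall g0, exists e1 e2,
      [/\ e1 \in F, e2 \in F, e1 != e2 & nth g0 gs i e1 = nth g0 gs i e2]].
Proof.
elim: gs E => [|g gs IH] E /=.
  rewrite mul0n => /card_gt0P[e eE]; exists [set e].
  by rewrite sub1set cards1; split.
rewrite mulSn => sE; have [|F [FE F0 Fs FP]] := IH (twins T C g E).
  rewrite -(ltn_add2r #|C|); apply: leq_trans (card_twins T C g E).
  by rewrite addnC.
have [e eF] := card_gt0P F0.
have := subsetP FE _ eF; rewrite inE => /andP[eE /existsP[e' /and3P[e'E ne /eqP ge]]].
exists (e' |: F); split.
- rewrite subUset sub1set e'E; apply: subset_trans FE _.
  by apply/subsetP => x; rewrite inE => /andP[].
- by apply/card_gt0P; exists e'; rewrite setU11.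
- by rewrite cardsU1; case: (_ \notin _); lia.
case=> [_|i ilt] g0 /=.
  by exists e, e'; rewrite setU11 setU1r // eq_sym; split.
have [e1 [e2 [h1 h2 h3 h4]]] := FP i ilt g0.
by exists e1, e2; rewrite !setU1r.
Qed.

Lemma exists_popular_pair (V X C : finType) (A : {set V}) (B : {set X})
    (h : V -> X -> C) (t : nat) :
  0 < #|C| -> #|B| = 2 * #|C| -> 4 * #|C| * t <= #|A| ->
  exists x y, [/\ x \in B, y \in B, x != y &
    t <= #|[set a in A | h a x == h a y]|].
Proof.
move=> C0 BC tA.
(* The averaging below compares [t] with [t.-1], which needs [t] positive. *)
case: (posnP t) => [->|t0].
  have [x xB] : exists x, x \in B by apply/card_gt0P; lia.
  have [y] : exists y, y \in B :\ x.
    by apply/card_gt0P; have := cardsD1 x B; rewrite xB; lia.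
  by rewrite !inE => /andP[yx yB]; exists x, y; rewrite eq_sym.
pose D a := [set u in setX B B | (u.1 != u.2) && (h a u.1 == h a u.2)].
have lo a : #|C| <= #|D a|.
  have := card_twins _ _ (h a) B.
  (* The first projection of [D a] covers the twins of [B], of which there are at least
     [2 * #|C| - #|C|]. *)
  suff : #|twins _ _ (h a) B| <= #|D a| by lia.
  apply: leq_trans (leq_imset_card fst (D a)).
  apply: subset_leq_card; apply/subsetP => x; rewrite inE.
  case/andP => xB /existsP[y /and3P[yB yx hxy]].
  by apply/imsetP; exists (x, y); rewrite // !inE /= xB yB hxy eq_sym yx.
have swap : \sum_(a in A) #|D a| =
    \sum_(u in setX B B | u.1 != u.2) #|[set a in A | h a u.1 == h a u.2]|.
  under eq_bigr => a _ do rewrite -sum1_card.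
  under [RHS]eq_bigr => u _ do rewrite -sum1_card.
  rewrite (exchange_big_dep (fun u => (u \in setX B B) && (u.1 != u.2))) /=; last first.
    by move=> a u _; rewrite inE => /and3P[-> ->].
  apply: eq_bigr => u /andP[uB une]; apply: eq_bigl => a.
  by rewrite !inE in uB *; rewrite uB une.
have [/existsP[[x y]]|] := boolP [exists u in setX B B, (u.1 != u.2) &&
    (t <= #|[set a in A | h a u.1 == h a u.2]|)].
  by rewrite !inE /= => /and3P[/andP[xB yB] xy tL]; exists x, y.
rewrite negb_exists => /forallP none; exfalso.
have up : \sum_(a in A) #|D a| <= (2 * #|C|) * (2 * #|C|) * t.-1.
  rewrite swap -BC -cardsX -sum_nat_const.
  apply: (@leq_trans (\sum_(u in setX B B | u.1 != u.2) t.-1)).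
    apply: leq_sum => u /andP[uB une].
    by have := none u; rewrite uB une /=; lia.
  by rewrite big_mkcondr /=; apply: leq_sum => u _; case: ifP.
have dn : #|A| * #|C| <= \sum_(a in A) #|D a|.
  by rewrite -sum_nat_const; apply: leq_sum => a _; apply: lo.
(* With [c = #|C|], the two bounds on the sum would give [4c^2 t <= 4c^2 (t - 1)]. *)
have := leq_trans dn up; rewrite leqNgt => /negP; apply.
apply: (@leq_trans (4 * #|C| * t * #|C|)); last by rewrite leq_mul2r tA orbT.
rewrite (_ : 4 * #|C| * t * #|C| = 2 * #|C| * (2 * #|C|) * t); last by lia.
by rewrite ltn_pmul2l ?prednK // !muln_gt0 C0.
Qed.

(** * The binomial bound for a local coloring *)

Lemma color_pair_not_rainbow (n k : nat) (g : {ffun {set 'I_n} -> 'I_k})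
    (E : {set {set 'I_n}}) (e1 e2 : {set 'I_n}) :
  e1 \in E -> e2 \in E -> e1 != e2 -> g e1 = g e2 -> ~~ rainbow g E.
Proof.
move=> e1E e2E ne eqg; apply/negP => /forallP /(_ e1); rewrite e1E /=.
by move=> /forallP /(_ e2); rewrite e2E eqg eqxx (negPf ne).
Qed.

Lemma card_edges_of (r n : nat) (S : {set 'I_n}) : #|edges_of r S| = 'C(#|S|, r).
Proof. exact: cards_draws. Qed.

Lemma edges_ofS (r n : nat) (S S' : {set 'I_n}) :
  S \subset S' -> edges_of r S \subset edges_of r S'.
Proof.
move=> SS'; apply/subsetP => e; rewrite !inE => /andP[eS ->].
by rewrite (subset_trans eS SS').
Qed.

Lemma local_coloring_bin_le (r p n k t : nat)
    (f : {ffun 'I_n -> {ffun {set 'I_n} -> 'I_k}}) :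
  2 <= r -> (2 * r - 1) * r + 2 * (r - 1) <= p -> local_coloring r p f ->
  0 < k -> p <= t -> 8 * k * t <= n -> 'C(t, r) <= r * k.
Proof.
move=> r2 rp locf k0 pt ktn; rewrite leqNgt; apply/negP => big.
have rt : r <= t by nia.
(* Averaging uses half of [8 * k * t]; the other half pays for removing [Z] and [B], as [r <= t]. *)
have kt : r + 2 * k + 4 * k * t <= n by nia.
have [Z _ cZ] : exists2 Z : {set 'I_n}, Z \subset setT & #|Z| = r - 2.
  by apply: exists_subset_card; rewrite cardsT card_ord; lia.
have [B BZ cB] : exists2 B : {set 'I_n}, B \subset ~: Z & #|B| = 2 * k.
  by apply: exists_subset_card; have := cardsC Z; rewrite card_ord; lia.
pose A := ~: (Z :|: B).
have cA : 4 * k * t <= #|A|.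
  have [cZB _] := leq_card_setU Z B; rewrite cZ cB in cZB.
  by have := cardsC (Z :|: B); rewrite card_ord -/A; lia.
pose edge (a x : 'I_n) := a |: (x |: Z).
have [] := @exists_popular_pair _ _ 'I_k A B (fun a x => f a (edge a x)) t.
- by rewrite card_ord.
- by rewrite card_ord.
- by rewrite card_ord.
move=> x [y [xB yB xy tL]].
have [L Lsub cL] := exists_subset_card _ _ _ tL.
pose W := x |: (y |: Z).
have xZ : x \notin Z by move/subsetP: BZ => /(_ x xB); rewrite inE.
have yZ : y \notin Z by move/subsetP: BZ => /(_ y yB); rewrite inE.
have cW : #|W| = r.
  by rewrite !cardsU1 !inE negb_or xy xZ yZ cZ; clear -r2; lia.
have LA a : a \in L -> a \notin Z /\ a \notin B.
  move=> /(subsetP Lsub); rewrite !inE => /andP[+ _].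
  by rewrite negb_or => /andP[].
have WL : [disjoint W & L].
  rewrite disjoint_subset; apply/subsetP => w; rewrite !inE => wW.
  apply/negP => /LA[wZ wB]; case/or3P: wW => [/eqP wx|/eqP wy|wZ'].
  - by rewrite wx xB in wB.
  - by rewrite wy yB in wB.
  - by rewrite wZ' in wZ.
have [] := @exists_repeating_subset _ 'I_k
    [seq (f w : _ -> _) | w <- enum W] (edges_of r L).
  by rewrite size_map -cardE cW card_ord card_edges_of cL.
move=> F [FL _ cF FP].
rewrite size_map -cardE cW in cF FP.
pose S0 := W :|: cover F.
have cS0 : #|S0| <= p.
  have cov : #|cover F| <= r.+1 * r.
    apply: leq_trans (leq_card_cover F) _.
    apply: (@leq_trans (\sum_(e in F) r)); last by rewrite sum_nat_const leq_mul2r cF orbT.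
    by apply: leq_sum => e /(subsetP FL); rewrite inE => /andP[_ /eqP ->].
  have : #|S0| <= r + r.+1 * r.
    by apply: leq_trans (leq_card_setU _ _) _; rewrite cW leq_add2l.
  (* The lower bound on [p] exceeds [r + (r + 1) r] by [(r - 2)(r + 1)], which vanishes at
     [r = 2]. *)
  by move: rp r2; clear; nia.
have covL : cover F \subset L.
  by apply/bigcupsP => e /(subsetP FL); rewrite inE => /andP[].
have S0WL : S0 \subset W :|: L by rewrite setUS.
(* Padding within [W :|: L], which has [r + t >= p] vertices, adds no vertex whose coloring is
   uncontrolled. *)
have [P PWL cP] : exists2 P : {set 'I_n},
    P \subset (W :|: L) :\: S0 & #|P| = p - #|S0|.
  apply: exists_subset_card; rewrite cardsD (setIidPr S0WL) leq_sub2r //.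
  by rewrite cardsU (disjoint_setI0 WL) cards0 cL subn0 (leq_trans pt) ?leq_addl.
pose S := S0 :|: P.
have cS : #|S| = p.
  rewrite cardsU cP (_ : S0 :&: P = set0) ?cards0; first by rewrite subn0 subnKC.
  apply: disjoint_setI0; rewrite disjoint_sym.
  rewrite disjoint_subset; apply: subset_trans PWL _.
  by apply/subsetP => v; rewrite !inE => /andP[].
have SWL : S \subset W :|: L.
  rewrite subUset S0WL /=; apply: subset_trans PWL _; exact: subsetDl.
have WS : W \subset S by rewrite /S /S0 -setUA subsetUl.
have FS : F \subset edges_of r S.
  apply/subsetP => e eF; have := subsetP FL e eF; rewrite !inE => /andP[_ ->].
  rewrite andbT; apply: subset_trans (subsetUl _ _).
  by apply: subset_trans (subsetUr _ _); apply: (bigcup_max e).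
move/forallP: locf => /(_ S); rewrite cS eqxx /= => /existsP[u /andP[uS]].
apply/negP; have := subsetP SWL u uS; rewrite in_setU => /orP[uW|uL].
  have iu : index u (enum W) < r by rewrite -cW cardE index_mem mem_enum.
  have [e1 [e2 [e1F e2F ne]]] := FP _ iu (f u).
  rewrite (nth_map u) ?nth_index ?mem_enum -?cardE ?cW // => ge.
  by apply: (@color_pair_not_rainbow _ _ _ _ e1 e2); rewrite ?(subsetP FS).
have [uZ uB] := LA u uL.
have ux : u != x by apply: contraNneq uB => ->.
have uy : u != y by apply: contraNneq uB => ->.
have edgeS z : z \in B -> z \in W -> z \notin Z -> u != z -> edge u z \in edges_of r S.
  move=> zB zW zZ uz; rewrite inE; apply/andP; split.
    rewrite !subUset !sub1set uS (subsetP WS) //=.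
    by apply: subset_trans WS; rewrite /W setUA subsetUr.
  by rewrite !cardsU1 !inE negb_or uz uZ zZ cZ; apply/eqP; clear -r2; lia.
apply: (@color_pair_not_rainbow _ _ _ _ (edge u x) (edge u y)).
- by apply: edgeS; rewrite // !inE eqxx.
- by apply: edgeS; rewrite // !inE eqxx orbT.
(* The two edges differ at [x]. *)
- apply/eqP => /setP /(_ x); rewrite !inE eqxx orbT /=.
  by rewrite eq_sym (negPf ux) (negPf xy) (negPf xZ).
- by move/subsetP: Lsub => /(_ u uL); rewrite inE => /andP[_ /eqP].
Qed.

(** * From the binomial bound to the power of [n] *)

Lemma leq_expn_ffact (t r : nat) : expn (t - r.-1) r <= t ^_ r.
Proof.
(* The base stays fixed while the exponent varies: each of the first [r] factors of [t ^_ r] is at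
   least [t - r.-1]. *)
suff ind m : m <= r -> expn (t - r.-1) m <= t ^_ m by exact: ind.
elim: m => [|m IH] mr; first by rewrite ffactn0.
by rewrite expnSr ffactnSr leq_mul ?IH ?leq_sub2l //; lia.
Qed.

(** The two summands of the constant serve two cases for [t = n %/ (8 * k)]: if [t < p] then
    [n < 8pk]; otherwise the binomial bound applies to [t]. *)
Lemma local_coloring_expn_le (r p n k : nat)
    (f : {ffun 'I_n -> {ffun {set 'I_n} -> 'I_k}}) :
  2 <= r -> (2 * r - 1) * r + 2 * (r - 1) <= p -> local_coloring r p f ->
  0 < k -> expn n r <= (expn (8 * p) r + expn 32 r * (r`! * r)) * expn k r.+1.
Proof.
move=> r2 rp locf k0; pose t := n %/ (8 * k).
have k80 : 0 < 8 * k by rewrite muln_gt0.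
have nt : n < 8 * k * t.+1 by rewrite mulnC ltn_ceil.
case: (ltnP t p) => [tp|pt].
  apply: (@leq_trans (expn (8 * p * k) r)).
    rewrite leq_exp2r; last by lia.
    apply: leq_trans (ltnW nt) _.
    by rewrite mulnAC leq_mul2r leq_mul2l tp !orbT.
  rewrite expnMn mulnDl; apply: leq_trans (leq_addr _ _).
  by rewrite leq_mul2l leq_pexp2l ?orbT.
have bin := @local_coloring_bin_le r p n k t f r2 rp locf k0 pt _.
have {}bin : 'C(t, r) <= r * k by apply: bin; rewrite mulnC leq_divM.
(* This factor 4, times the 8 in the choice of [t], gives the 32. *)
have tr : t.+1 <= 4 * (t - r.-1).
  have : 2 * r <= t by apply: leq_trans pt; apply: leq_trans rp; clear -r2; nia.
  by move: r2; clear; lia.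
apply: (@leq_trans (expn (32 * k * (t - r.-1)) r)).
  rewrite leq_exp2r; last by lia.
  apply: leq_trans (ltnW nt) _.
  rewrite (_ : 32 * k * (t - r.-1) = 8 * k * (4 * (t - r.-1))); last by lia.
  by rewrite leq_mul2l tr orbT.
rewrite mulnDl; apply: leq_trans (leq_addl _ _).
rewrite !expnMn expnS (_ : expn 32 r * (r`! * r) * (k * expn k r) =
  expn 32 r * expn k r * (r * k * r`!)); last by lia.
rewrite leq_mul2l; apply/orP; right.
apply: leq_trans (leq_expn_ffact t r) _.
by rewrite -bin_ffact leq_mul2r bin orbT.
Qed.

Lemma expn_le_Cr (r p n : nat) :
  2 <= r -> (2 * r - 1) * r + 2 * (r - 1) <= p -> 0 < n ->
  expn n r <= (expn (8 * p) r + expn 32 r * (r`! * r)) * expn (Cr r n p) r.+1.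
Proof.
move=> r2 rp n0; rewrite /Cr; case: ex_minnP => k + _.
have p0 : (p == 0) = false by apply/eqP; move: r2 rp; clear; nia.
rewrite /Cpred p0 /= => /existsP[f locf].
apply: (local_coloring_expn_le _ _ _ _ _ r2 rp locf).
(* Any value of [f] inhabits ['I_k], so [k] is positive. *)
exact: leq_ltn_trans (leq0n _) (ltn_ord (f (Ordinal n0) set0)).
Qed.

Lemma INR_expn (m r : nat) : INR (expn m r) = (INR m ^ r)%R.
Proof. by elim: r => [|r IH] //=; rewrite expnS mult_INR IH. Qed.

Theorem theorem3 (r p : nat) :
  2 <= r -> (2 * r - 1) * r + 2 * (r - 1) <= p ->
  exists (c : R) (N : nat), (0 < c)%R /\
    forall n : nat, N <= n ->
      (c * Rpower (INR n) (INR r / INR (r + 1)) <= INR (Cr r n p))%R.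
Proof.
move=> r2 rp.
set D := expn (8 * p) r + expn 32 r * (r`! * r).
have rR : (0 < INR (r + 1))%R by apply: (lt_INR 0); lia.
have D0 : (0 < INR D)%R.
  apply: (lt_INR 0); apply/ltP; rewrite addn_gt0 !muln_gt0 !expn_gt0 fact_gt0.
  by rewrite (ltnW r2) orbT.
(* The constant comes from taking [(r + 1)]-th roots in [n^r <= D C^(r+1)], valid once [n > 0]. *)
exists (/ Rpower (INR D) (/ INR (r + 1)))%R, 1; split.
  by apply: Rinv_0_lt_compat; apply: exp_pos.
move=> n n1; have /leP/le_INR := expn_le_Cr r p n r2 rp n1.
rewrite -/D mult_INR !INR_expn => main.
have nR : (0 < INR n)%R by apply: (lt_INR 0); apply/ltP.
(* [Rpower] goes through the logarithm, so its laws need a positive base. *)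
have C0 : (0 < INR (Cr r n p))%R.
  apply: (lt_INR 0); apply/ltP; rewrite lt0n; apply/eqP => C0.
  have := pow_lt _ r nR; move: main; rewrite C0 /=; lra.
apply: (Rmult_le_reg_l (Rpower (INR D) (/ INR (r + 1)))); first exact: exp_pos.
rewrite -Rmult_assoc Rinv_r ?Rmult_1_l; last by apply: Rgt_not_eq; apply: exp_pos.
have -> : INR (Cr r n p) = Rpower (INR (Cr r n p) ^ r.+1) (/ INR (r + 1)).
  rewrite -Rpower_pow // Rpower_mult addn1 Rinv_r ?Rpower_1 //.
  by rewrite -addn1; apply: Rgt_not_eq.
rewrite /Rdiv -Rpower_mult Rpower_pow //.
rewrite (Rpower_mult_distr (INR D)) //; last exact: pow_lt.
apply: Rle_Rpower_l; last by split => //; apply: pow_lt.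
by apply: Rlt_le; apply: Rinv_0_lt_compat.
Qed.
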